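(* Let $C$ be a call pricing function, let $P$ be the corresponding put pricing function, and let $T>0$ be a fixed expiry; write $P(K)=P(T,K)$ and let $I(K)=I(T,K)$ be the implied volatility associated with $C$. Then, as $K\to0$, $$I(K)=\frac{\sqrt2}{\sqrt T}\left[\sqrt{\log\frac1{P(K)}}-\sqrt{\log\frac K{P(K)}}\right]+O\left(\left(\log\frac K{P(K)}\right)^{-\frac12}\log\log\frac K{P(K)}\right).$$
   Context: Fix $r\ge 0$ (interest rate) and $x_0>0$ (initial condition). A stock price process is a positive adapted process $X$ on a filtered probability space $(\Omega,\mathcal F,\mathcal F_t,\mathbb P^* )$ such that $X_0=x_0$ $\mathbb P^*$-a.s., $\mathbb E^*[X_t]<\infty$ for all $t\ge0$, $X_t$ is an unbounded random variable for every $t>0$, and $e^{-rt}X_t$ is an $(\mathcal F_t,\mathbb P^* )$-martingale. The associated call and put pricing functions are $C(T,K)=e^{-rT}\mathbb E^*[(X_T-K)^+]$ and $P(T,K)=e^{-rT}\mathbb E^*[(K-X_T)^+]$, $T,K\ge0$, where $u^+=\max\{u,0\}$. Black-Scholes function: $C_{BS}(T,K,\sigma)=x_0N(d_1)-Ke^{-rT}N(d_2)$, where $N$ is the standard normal distribution function, $d_1=\frac{\log x_0-\log K+(r+\sigma^2/2)T}{\sigma\sqrt T}$, $d_2=d_1-\sigma\sqrt T$. The implied volatility $I(T,K)$ associated with $C$ is the unique number satisfying $C_{BS}(T,K,I(T,K))=C(T,K)$. $\varphi_1(K)=\varphi_2(K)+O(\rho(K))$ as $K\to0$ means $|\varphi_1(K)-\varphi_2(K)|\le\alpha\rho(K)$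 for some $\alpha>0$ and all sufficiently small $K>0$. *)

(* Defs.v *)
From HB Require Import structures.
From mathcomp Require Import all_boot all_order all_algebra.
From mathcomp Require Import all_classical all_reals all_analysis.

Set Implicit Arguments.
Unset Strict Implicit.
Unset Printing Implicit Defensive.
Import Order.TTheory GRing.Theory Num.Theory.
Import numFieldNormedType.Exports.
Local Open Scope classical_set_scope.
Local Open Scope ring_scope.

Section processes.
Context {R : realType} {d : measure_display} {Omega : measurableType d}.
Variable Q : probability Omega R.

Definition measurable_wrt (G : set (set Omega)) (f : Omega -> R) : Prop :=
  forall B : set R, measurable B -> G (f @^-1` B).

(* [Y] is a version of E[Z | G]; [G] is meant to be a sub-sigma-algebra of
   the measurable sets and [Z] to be integrable. *)
Definition is_cond_expectation (G : set (set Omega)) (Z Y : Omega -> R)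
    : Prop :=
  [/\ measurable_wrt G Y,
      Q.-integrable setT (EFin \o Y) &
      forall A, G A ->
        (\int[Q]_(w in A) (Y w)%:E = \int[Q]_(w in A) (Z w)%:E)%E].

(* The time axis is [0, +oo): values of filtrations and processes at negative
   times are unconstrained, here and below. *)
Definition is_filtration (F : R -> set (set Omega)) : Prop :=
  [/\ forall t, 0 <= t -> sigma_algebra setT (F t),
      forall t, 0 <= t -> F t `<=` measurable &
      forall s t, 0 <= s -> s <= t -> F s `<=` F t].

Definition is_adapted (F : R -> set (set Omega)) (X : R -> Omega -> R)
    : Prop :=
  forall t, 0 <= t -> measurable_wrt (F t) (X t).

Definition is_martingale (F : R -> set (set Omega)) (M : R -> Omega -> R)
    : Prop :=
  [/\ is_adapted F M,
      forall t, 0 <= t -> Q.-integrable setT (EFin \o M t) &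
      forall s t, 0 <= s -> s <= t -> is_cond_expectation (F s) (M t) (M s)].

(* As usual for random variables, "unbounded" means not almost surely
   bounded. *)
Definition is_unbounded (Y : Omega -> R) : Prop :=
  forall c : R, (0 < Q [set w | (c < `|Y w|)%R])%E.

Record stock_price_process (F : R -> set (set Omega)) (r x0 : R)
    (X : R -> Omega -> R) : Prop := {
  spp_positive : forall t w, 0 <= t -> 0 < X t w;
  spp_adapted : is_adapted F X;
  spp_initial : {ae Q, forall w, X 0 w = x0};
  spp_finite : forall t, 0 <= t -> ('E_Q[X t] < +oo)%E;
  spp_unbounded : forall t, 0 < t -> is_unbounded (X t);
  spp_martingale :
    is_martingale F (fun t w => expR (- (r * t)) * X t w)
}.

Definition call_price (r : R) (X : R -> Omega -> R) (T K : R) : R :=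
  expR (- (r * T)) * fine 'E_Q[fun w => Num.max (X T w - K) 0].

Definition put_price (r : R) (X : R -> Omega -> R) (T K : R) : R :=
  expR (- (r * T)) * fine 'E_Q[fun w => Num.max (K - X T w) 0].

End processes.

Section black_scholes.
Context {R : realType}.

Definition std_normal_cdf (x : R) : R :=
  fine (normal_prob (0 : R) 1 `]-oo, x]).

Definition bs_d1 (x0 r T K sigma : R) : R :=
  (ln x0 - ln K + (r + sigma ^+ 2 / 2) * T) / (sigma * Num.sqrt T).

Definition bs_d2 (x0 r T K sigma : R) : R :=
  bs_d1 x0 r T K sigma - sigma * Num.sqrt T.

Definition bs_call (x0 r T K sigma : R) : R :=
  x0 * std_normal_cdf (bs_d1 x0 r T K sigma)
  - K * expR (- (r * T)) * std_normal_cdf (bs_d2 x0 r T K sigma).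

(* For T, K > 0, [bs_call] is strictly increasing in sigma > 0, so there is at
   most one solution.  For the call price of a stock price process there is
   none exactly when the price equals the lower no-arbitrage bound
   max(x0 - K exp(-rT), 0); the value is then 0, in accordance with the limit
   of [bs_call] as sigma tends to 0 from above. *)
Definition implied_volatility (x0 r : R) (C : R -> R -> R) (T K : R) : R :=
  xget 0 [set sigma | 0 < sigma /\ bs_call x0 r T K sigma = C T K].

Definition eq_upto_bigO_at0 (phi1 phi2 rho : R -> R) : Prop :=
  exists2 alpha : R, 0 < alpha &
    \forall K \near 0^'+, `|phi1 K - phi2 K| <= alpha * rho K.

End black_scholes.

(* Main.v *)
Require Import Defs.
From HB Require Import structures.
From mathcomp Require Import all_boot all_order all_algebra.
From mathcomp Require Import all_classical all_reals all_analysis.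
From mathcomp Require Import measurable_realfun ring lra.
Import Order.TTheory GRing.Theory Num.Theory.
Import numFieldNormedType.Exports.
Set Implicit Arguments.
Unset Strict Implicit.
Unset Printing Implicit Defensive.
Local Open Scope classical_set_scope.
Local Open Scope ring_scope.

(** Put k = K exp(-rT), s = sigma sqrt T and L = ln (x0 / k) = s d2 + s^2 / 2.
    By put-call parity sigma is the implied volatility iff
    P / k = (1 - N(d2)) - e^L (1 - N(d2 + s)),
    whose right-hand side equals
    \int_{d2}^{oo} phi(u) (1 - e^{- s (u - d2)}) du.
    It is at most e^{- d2^2 / 2} and at least c d2^{-3} e^{- d2^2 / 2} as soon
    as d2, L >= 1, so that d2^2 / 2 = ln (K / P) + O(ln ln (K / P)). Solving
    L = s d2 + s^2 / 2 for s gives s = sqrt (d2^2 + 2 L) - d2, and replacing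
    d2^2 / 2 by ln (K / P) and L by ln (1 / K) costs the stated error.
    Moreover K / P tends to infinity because P / k <= Prob (X_T <= K). If
    P(K) = 0, no sigma > 0 is a solution, and by the conventions ln 0 = 0 and
    1 / 0 = 0 both sides of the bound vanish. *)

(** * The standard normal law, its tail, and bounds for the normalized put price *)

Section normal_tail.
Context {R : realType}.
Local Notation N := (@std_normal_cdf R).
Local Notation phi := (@normal_pdf R 0 1).
Implicit Types x a b s d L q : R.

Lemma std_normal_pdfE x : phi x = phi 0 * expR (- x ^+ 2 / 2).
Proof.
rewrite normal_pdfE ?oner_neq0// /normal_fun subrr subr0 expr1n -[1 *+ 2]/2.
by rewrite expr0n oppr0 mul0r expR0 mulr1.
Qed.

Lemma std_normal_pdf0_gt0 : 0 < phi 0.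
Proof.
by rewrite normal_pdfE ?oner_neq0// mulr_gt0 ?expR_gt0// normal_peak_gt0 ?oner_neq0.
Qed.

Lemma std_normal_pdf0_le1 : phi 0 <= 1.
Proof.
apply: (le_trans (normal_pdf_ub _ _ (oner_neq0 _))).
rewrite /normal_peak expr1n mul1r invf_le1 ?sqrtr_gt0; last first.
  by rewrite mulrn_wgt0 ?pi_gt0.
rewrite -[leLHS]sqrtr1 ler_wsqrtr// -mulr_natr.
by have := @pi_ge2 R; lra.
Qed.

Lemma std_normal_cdf_le1 x : N x <= 1.
Proof.
by rewrite /std_normal_cdf -lee_fin fineK ?fin_num_measure// probability_le1.
Qed.

Lemma std_normal_cdf_le x y : x <= y -> N x <= N y.
Proof.
move=> xy; rewrite /std_normal_cdf fine_le ?fin_num_measure//.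
by rewrite le_measure ?inE//; exact: subitvPr.
Qed.

(** The identity as a random variable under the normal law: [N] is its distribution function, so the
    limits of [cdf] at infinity carry over. *)
Let idTR : measurableTypeR R -> R := idfun.

#[local] HB.instance Definition _ :=
  @isMeasurableFun.Build _ _ _ _ idTR (@measurable_id _ _ setT).

Let X : {RV (normal_prob (0 : R) 1) >-> R} := idTR.

Let std_normal_cdfE : N = fine \o cdf X.
Proof. by []. Qed.

Lemma cvg_std_normal_cdfy : N x @[x --> +oo] --> (1 : R).
Proof. by rewrite std_normal_cdfE; apply: fine_cvg; exact: cvg_cdfy1. Qed.

Lemma cvg_std_normal_cdfNy : N x @[x --> -oo] --> (0 : R).
Proof. by rewrite std_normal_cdfE; apply: fine_cvg; exact: cvg_cdfNy0. Qed.

Lemma is_derive_std_normal_cdf x : is_derive x 1 N (phi x).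
Proof.
have int u : lebesgue_measure.-integrable `]-oo, u] (EFin \o phi).
  by apply: (integrableS _ _ (subsetT _)) => //; exact: integrable_normal_pdf.
have [|||dN <-] := @continuous_FTC1 R phi -oo%O x (x + 1) _ (int _) _ _.
- by rewrite ltrDl.
- by rewrite ltNyr.
- by apply: continuous_normal_pdf; exact: oner_neq0.
apply: DeriveDef => //; rewrite derive1E; congr ('D_1 _ x).
Qed.

Lemma continuous_std_normal_cdf : continuous N.
Proof.
move=> x; apply/differentiable_continuous/derivable1_diffP.
by have [] := is_derive_std_normal_cdf x.
Qed.

Lemma derive_le0_nincr (f df : R -> R) a :
  (forall x, a <= x -> is_derive x 1 f (df x)) ->
  (forall x, a <= x -> df x <= 0) ->
  forall x y, a <= x -> x <= y -> f y <= f x.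
Proof.
move=> fdf df0 x y ax xy.
have [||c] := @MVT_segment R f df x y xy.
- move=> z; rewrite in_itv/= => /andP[/ltW xz _]; apply: fdf; exact: le_trans xz.
- apply/continuous_in_subspaceT => z; rewrite inE/= in_itv/= => /andP[xz _].
  apply/differentiable_continuous/derivable1_diffP.
  by have [] := fdf _ (le_trans ax xz).
rewrite in_itv/= => /andP[xc _] e; rewrite -subr_le0 e mulr_le0_ge0 ?subr_ge0//.
by apply: df0; exact: le_trans xc.
Qed.

(** A substitute for improper integration: tail inequalities follow from the sign of a derivative
    and a limit at infinity. *)
Lemma cvg_derive_le0_le (f df : R -> R) a l :
  (forall x, a <= x -> is_derive x 1 f (df x)) ->
  (forall x, a <= x -> df x <= 0) -> f x @[x --> +oo] --> l ->
  forall b, a <= b -> l <= f b.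
Proof.
move=> fdf df0 fl b ab; apply: (cvgr_to_le fl).
near=> x; apply: (derive_le0_nincr fdf df0 ab).
by near: x; exact: nbhs_pinfty_ge (num_real _).
Unshelve. all: by end_near. Qed.

Lemma cvg_expR_sqr : expR (- x ^+ 2 / 2) @[x --> +oo] --> (0 : R).
Proof.
have h : expR (- x) @[x --> +oo] --> (0 : R) by exact: cvgr_expR.
apply: (@squeeze_cvgr _ _ _ _ (cst 0) (fun x => expR (- x))) => //;
  last exact: cvg_cst.
near=> x; rewrite expR_ge0 ler_expR/=.
have : 2 <= x by near: x; exact: nbhs_pinfty_ge (num_real _).
by nra.
Unshelve. all: by end_near. Qed.

(** The right side minus the left has a nonpositive derivative for u >= 1, because [phi 0 <= 1], and
    tends to 0. *)
Lemma std_normal_tail_le x : 1 <= x -> 1 - N x <= expR (- x ^+ 2 / 2).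
Proof.
move=> x1; rewrite -subr_ge0.
pose f (u : R) := expR (- u ^+ 2 / 2) - (1 - N u).
pose df (u : R) := (phi 0 - u) * expR (- u ^+ 2 / 2).
apply: (@cvg_derive_le0_le f df 1 _ _ _ _ x x1).
- move=> u _.
  have := is_derive_std_normal_cdf u => dN.
  apply: is_derive_eq.
  rewrite /df (std_normal_pdfE u) /GRing.scale/=. by field.
- move=> u u1; rewrite mulr_le0_ge0 ?expR_ge0// subr_le0.
  exact: le_trans std_normal_pdf0_le1 u1.
- rewrite -[0](_ : 0 - (1 - 1) = 0 :> R); last by rewrite !subrr.
  apply: cvgB; first exact: cvg_expR_sqr.
  by apply: cvgB; [exact: cvg_cst|exact: cvg_std_normal_cdfy].
Qed.

(* [put_gap d2 s] is the ratio of the Black-Scholes put price to the discounted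
   strike k, where s = sigma * sqrt T and d1 = d2 + s; the coefficient is the
   forward moneyness x0 / k. *)
Definition put_gap d s : R :=
  (1 - N d) - expR (s * d + s ^+ 2 / 2) * (1 - N (d + s)).

(** One factor 1/d is the length of an interval of integration, 1/(3 d^2) bounds 1 - e^{-s (u - d)}
    there, and [expR (- 4)] accounts for the decay of the density on it. *)
Definition put_gap_minorant d : R :=
  phi 0 * expR (- 4) / 3 / d ^+ 3 * expR (- d ^+ 2 / 2).

Lemma put_gap_minorant_gt0 d : 0 < d -> 0 < put_gap_minorant d.
Proof.
move=> d0; rewrite !mulr_gt0 ?invr_gt0 ?expR_gt0 ?exprn_gt0//.
exact: std_normal_pdf0_gt0.
Qed.

(** The maximum with 1 covers every real [d], so that a small gap can later be seen to force d >=
    1. *)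
Lemma put_gap_ge d s : 0 < s -> 1 <= s * d + s ^+ 2 / 2 ->
  put_gap_minorant (Num.max d 1) <= put_gap d s.
Proof.
move=> s0 L1; set D := Num.max d 1.
have D1 : 1 <= D by rewrite le_max lexx orbT.
have dD : d <= D by rewrite le_max lexx.
have D0 : 0 < D by exact: lt_le_trans D1.
(* put_gap d s is the integral over [d, +oo[ of the absolute value of dg; the
   bound only keeps [D + 1/D, D + 2/D], where phi >= phi 0 e^-4 e^(- D^2 / 2)
   and s (u - d) >= 1 / (2 D^2). *)
pose g a := (1 - N a) - expR (s * d + s ^+ 2 / 2) * (1 - N (a + s)).
pose dg a := - (phi 0 * expR (- a ^+ 2 / 2) * (1 - expR (- (s * (a - d))))).
have gdg a : is_derive a 1 g (dg a).
  have dN := is_derive_std_normal_cdf a.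
  have dNs : is_derive a 1 (fun x => N (x + s)) (phi (a + s)).
    have dN' := is_derive_std_normal_cdf (a + s).
    have ds : is_derive a 1 (fun x : R => x + s) 1.
      by apply: is_derive_eq; rewrite addr0.
    rewrite -[phi _]mulr1; exact: (@is_derive1_comp _ N (fun x : R => x + s)).
  apply: is_derive_eq.
  rewrite /dg (std_normal_pdfE a) (std_normal_pdfE (a + s)) /GRing.scale/=.
  (* Completing the square: the coefficient turns the density at a + s into e^{-s (a - d)} times the
     density at a. *)
  have -> : expR (- (s * (a - d))) = expR (s * d + s ^+ 2 / 2) *
      expR (- (a + s) ^+ 2 / 2) / expR (- a ^+ 2 / 2).
    by rewrite -expRD -expRN -expRD; congr expR; field.
  by field; rewrite gt_eqF// expR_gt0.
have dg0 a : d <= a -> dg a <= 0.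
  move=> da; rewrite oppr_le0 !mulr_ge0 ?expR_ge0 ?(ltW std_normal_pdf0_gt0)//.
  by rewrite subr_ge0 -[leRHS]expR0 ler_expR oppr_le0 mulr_ge0 ?subr_ge0// ltW.
have cg : g x @[x --> +oo] --> (0 : R).
  have -> : 0 = (1 - 1) - expR (s * d + s ^+ 2 / 2) * (1 - 1) :> R.
    by rewrite !subrr mulr0 subrr.
  apply: cvgB; first by apply: cvgB; [exact: cvg_cst|exact: cvg_std_normal_cdfy].
  apply: cvgM; first exact: cvg_cst.
  apply: cvgB; first exact: cvg_cst.
  apply: (@cvg_comp _ _ _ (fun x => x + s) N _ +oo); first exact: cvg_addrr.
  exact: cvg_std_normal_cdfy.
have Di0 : 0 < D^-1 by rewrite invr_gt0.
set a := D + D^-1; set b := D + 2 * D^-1.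
have ab : a <= b by rewrite /a /b; lra.
have da : d <= a by rewrite /a; lra.
have gb : 0 <= g b by apply: (cvg_derive_le0_le (fun x _ => gdg x) dg0 cg); lra.
have gad : g a <= g d by exact: (derive_le0_nincr (fun x _ => gdg x) dg0).
suff : put_gap_minorant D <= g a - g b.
  by rewrite -[put_gap d s]/(g d) => ?; lra.
have [|c] := @MVT_segment R g dg a b ab (fun x _ => gdg x).
  apply/continuous_subspaceT => z.
  by apply/differentiable_continuous/derivable1_diffP; have [] := gdg z.
rewrite in_itv/= => /andP[ac cb] gbg.
have -> : g a - g b =
    phi 0 * expR (- c ^+ 2 / 2) * (1 - expR (- (s * (c - d)))) * D^-1.
  by rewrite -opprB gbg /dg /b /a; ring.
have DD : D * D^-1 = 1 by rewrite mulfV// gt_eqF.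
have Di1 : D^-1 <= 1 by rewrite invf_le1.
(* Since c <= D + 2/D and D >= 1, c^2 <= D^2 + 4 + 4/D^2 <= D^2 + 8. *)
have e1 : expR (- 4) * expR (- D ^+ 2 / 2) <= expR (- c ^+ 2 / 2).
  rewrite -expRD ler_expR.
  suff : c ^+ 2 <= b ^+ 2 by rewrite /b; nra.
  by rewrite ler_sqr ?nnegrE//; rewrite /a /b in ac cb *; lra.
(* Otherwise s d < 1/2 and s < 1/2, so s d + s^2/2 < 1, against [L1]. *)
have sD : 1 <= 2 * s * D.
  rewrite leNgt; apply/negP => sD.
  have : s * d <= s * D by rewrite ler_pM2l.
  by nra.
(* Here s (c - d) >= w = 1/(2 D^2), and 1 - e^{-w} >= 1 - 1/(1 + w) = 1/(2 D^2 + 1). *)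
have e2 : (3 * D ^+ 2)^-1 <= 1 - expR (- (s * (c - d))).
  set w := (2 * D ^+ 2)^-1.
  have w0 : 0 < w by rewrite invr_gt0 mulr_gt0// exprn_gt0.
  have : w <= s * (c - d).
    have : D^-1 <= c - d by rewrite /a in ac; lra.
    move=> h; have : s * D^-1 <= s * (c - d) by rewrite ler_pM2l.
    apply: le_trans; rewrite /w invfM expr2 invfM.
    by rewrite mulrCA [leRHS]mulrC ler_pM2l// -ler_pdivlMr; nra.
  move=> ws; have ew : expR (- (s * (c - d))) <= (1 + w)^-1.
    rewrite expRN lef_pV2 ?posrE ?expR_gt0//; last by lra.
    by rewrite (le_trans _ (expR_ge1Dx _))//; lra.
  apply: (@le_trans _ _ (1 - (1 + w)^-1)); last by rewrite lerD2l lerN2.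
  have D2 : 1 <= D ^+ 2 by rewrite exprn_ege1.
  have -> : (1 + w)^-1 = 1 - (2 * D ^+ 2 + 1)^-1.
    by rewrite /w; field; rewrite !gt_eqF//=; nra.
  by rewrite subKr lef_pV2 ?posrE; nra.
have -> : put_gap_minorant D =
    phi 0 * (expR (- 4) * expR (- D ^+ 2 / 2)) * (3 * D ^+ 2)^-1 * D^-1.
  by rewrite /put_gap_minorant; field; rewrite gt_eqF.
have p0 := std_normal_pdf0_gt0.
rewrite ler_pM2r//; apply: ler_pM => //; last by rewrite ler_pM2l.
  by rewrite !mulr_ge0 ?expR_ge0 ?(ltW p0).
by rewrite invr_ge0 mulr_ge0 ?sqr_ge0.
Qed.

Lemma put_gap_le d s : 1 <= d -> put_gap d s <= expR (- d ^+ 2 / 2).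
Proof.
move=> d1; apply: le_trans (std_normal_tail_le d1).
by rewrite /put_gap gerBl mulr_ge0 ?expR_ge0// subr_ge0 std_normal_cdf_le1.
Qed.

End normal_tail.

(** * From the normalized put price to the implied volatility *)

Section implied_volatility_asymptotics.
Context {R : realType}.
Local Notation N := (@std_normal_cdf R).
Local Notation phi := (@normal_pdf R 0 1).
Implicit Types x a b d s L q : R.

(** Existence of the implied volatility, by the intermediate value theorem: along d = L/s - s/2 the
    coefficient e^L stays fixed, and the gap is below q for small s and above q for large s. *)
Lemma put_gap_surj L q : 0 < L -> 0 < q < 1 ->
  exists2 s, 0 < s & put_gap (L / s - s / 2) s = q.
Proof.
move=> L0 /andP[q0 q1].
pose f s := put_gap (L / s - s / 2) s.
have [M [M1 Mq]] : exists M : R, 1 <= M /\ expR (- M ^+ 2 / 2) <= q.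
  have /cvgr0Pnorm_lt/(_ _ q0) := @cvg_expR_sqr R.
  move=> h; near (+oo : set_system R) => M; exists M; split.
    by near: M; exact: nbhs_pinfty_ge (num_real _).
  have : `|expR (- M ^+ 2 / 2)| < q by near: M.
  by rewrite ger0_norm ?expR_ge0// => /ltW.
(* Both [e] and [expR L * e] are at most (1 - q)/2, so the gap is at least q once [N d] and the tail
   at d + s are at most [e]. *)
pose e := (1 - q) / 2 * Num.min 1 (expR (- L)).
have e0 : 0 < e by rewrite mulr_gt0 ?lt_min ?expR_gt0 ?ltr01//; lra.
have [A [A1 AN Ae]] : exists A : R,
    [/\ 1 <= A, N (- A) <= e & expR (- A ^+ 2 / 2) <= e].
  have /cvgr0Pnorm_lt/(_ _ e0) h := @cvg_expR_sqr R.
  have /cvgNy_compNP/cvgr0Pnorm_lt/(_ _ e0) h' := @cvg_std_normal_cdfNy R.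
  near (+oo : set_system R) => A; exists A; split.
  - by near: A; exact: nbhs_pinfty_ge (num_real _).
  - have : `|N (- A)| < e by near: A.
    by move/ltW; apply: le_trans; exact: ler_norm.
  - have : `|expR (- A ^+ 2 / 2)| < e by near: A.
    by rewrite ger0_norm ?expR_ge0// => /ltW.
(* L/s0 >= M + 1 and s0 <= 1 give d >= M. *)
pose s0 := Num.min 1 (L / (M + 1)).
have s00 : 0 < s0 by rewrite lt_min ltr01 divr_gt0//; lra.
have s01 : s0 <= 1 by rewrite ge_min lexx.
(* As s1 >= 2, L/s1 <= L/2; hence d <= -A and d + s1 >= A. *)
pose s1 := 2 * A + 2 * L.
have s012 : s0 <= s1 by rewrite /s1; lra.
have fs0 : f s0 <= q.
  have : M + 1 <= L / s0.
    rewrite ler_pdivlMr// mulrC -ler_pdivlMr; last by lra.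
    by rewrite ge_min lexx orbT.
  move=> h; have d1 : M <= L / s0 - s0 / 2 by lra.
  rewrite (le_trans (put_gap_le _ _)) ?(le_trans M1)// (le_trans _ Mq)//.
  by rewrite ler_expR; nra.
have s1ge : 0 < s1 by rewrite /s1; lra.
have eq1 : e <= (1 - q) / 2.
  by rewrite /e ler_piMr ?ge_min ?lexx//; lra.
have eq2 : expR L * e <= (1 - q) / 2.
  rewrite /e mulrCA ler_piMr//; first by lra.
  rewrite minr_pMr ?expR_ge0// ge_min; apply/orP; right.
  by rewrite -expRD subrr expR0.
have fs1 : q <= f s1.
  have Ls1 : L / s1 <= L / 2.
    by rewrite ler_pM2l// lef_pV2 ?posrE//; rewrite /s1; lra.
  have Ls10 : 0 < L / s1 by exact: divr_gt0.
  rewrite /f /put_gap.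
  have -> : s1 * (L / s1 - s1 / 2) + s1 ^+ 2 / 2 = L by field; rewrite gt_eqF.
  have -> : L / s1 - s1 / 2 + s1 = L / s1 + s1 / 2 by field; rewrite gt_eqF.
  have Nd2 : N (L / s1 - s1 / 2) <= e.
    apply: le_trans AN; apply: std_normal_cdf_le; rewrite /s1 in Ls1 *; lra.
  have Nd1 : 1 - N (L / s1 + s1 / 2) <= e.
    apply: le_trans Ae; apply: le_trans (std_normal_tail_le _) _.
      by rewrite /s1 in Ls10 *; lra.
    have : A <= L / s1 + s1 / 2 by rewrite /s1 in Ls10 *; lra.
    by rewrite ler_expR; nra.
  have : expR L * (1 - N (L / s1 + s1 / 2)) <= expR L * e.
    by rewrite ler_pM2l ?expR_gt0.
  by lra.
have [||s] := @IVT R f s0 s1 q s012.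
- apply/continuous_in_subspaceT => s; rewrite inE/= in_itv/= => /andP[s0s _].
  have sp : 0 < s by exact: lt_le_trans s0s.
  have cd : {for s, continuous (fun s => L / s - s / 2)}.
    apply: cvgB; last by apply: cvgM; [exact: cvg_id|exact: cvg_cst].
    by apply: cvgM; [exact: cvg_cst|apply: cvgV; [rewrite gt_eqF|exact: cvg_id]].
  apply: cvgB.
    apply: cvgB; first exact: cvg_cst.
    by apply: (@cvg_comp _ _ _ _ N _ _ _ cd); exact: continuous_std_normal_cdf.
  apply: cvgM.
    apply: (cvg_comp _ expR); last exact: continuous_expR.
    apply: cvgD; first by apply: cvgM; [exact: cvg_id|exact: cd].
    by apply: cvgM; [exact: exprn_continuous|exact: cvg_cst].
  apply: cvgB; first exact: cvg_cst.
  apply: (cvg_comp (fun s => L / s - s / 2 + s) N).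
    by apply: cvgD; [exact: cd|exact: cvg_id].
  exact: continuous_std_normal_cdf.
- by rewrite ge_min fs0 le_max fs1 orbT.
rewrite in_itv/= => /andP[s0s _] fq; exists s => //; exact: lt_le_trans s0s.
Unshelve. all: by end_near. Qed.

(** For d < 1 the gap would be at least [put_gap_minorant 1]. The rest takes logarithms of the two
    bounds on the gap; [3 * ln d] comes from the factor d^{-3}. *)
Lemma half_sqr_put_gap d s : 0 < s -> 1 <= s * d + s ^+ 2 / 2 ->
  put_gap d s < put_gap_minorant 1 ->
  [/\ 1 <= d, d ^+ 2 / 2 <= - ln (put_gap d s) &
      - ln (put_gap d s) <=
        d ^+ 2 / 2 + 3 * ln d - ln (phi 0 * expR (- 4) / 3)].
Proof.
move=> s0 L1 q1; have lb := put_gap_ge s0 L1.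
have d1 : 1 <= d.
  rewrite leNgt; apply/negP => d1; move: lb.
  by rewrite max_r ?(ltW d1)// leNgt q1.
have d0 : 0 < d by exact: lt_le_trans d1.
rewrite max_l// in lb.
have m0 := put_gap_minorant_gt0 d0.
have g0 := lt_le_trans m0 lb.
split => //.
  by rewrite lerNr -ler_expR lnK ?posrE// -mulNr put_gap_le.
have c0 : 0 < phi 0 * expR (- 4) / 3.
  by rewrite divr_gt0// mulr_gt0 ?expR_gt0 ?std_normal_pdf0_gt0.
have : ln (put_gap_minorant d) <= ln (put_gap d s) by rewrite ler_ln.
rewrite /put_gap_minorant lnM ?posrE ?expR_gt0 ?(divr_gt0 c0) ?exprn_gt0//.
rewrite ln_div ?posrE ?exprn_gt0// lnXn// expRK; lra.
Qed.

(** Put-call parity for the Black-Scholes formula: write N = 1 - (1 - N) and use x0 = K e^{-rT}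
    e^L. *)
Lemma bs_callE x0 r T K sigma : 0 < x0 -> 0 < T -> 0 < K -> 0 < sigma ->
  let s := sigma * Num.sqrt T in
  let L := ln x0 - ln K + r * T in
  bs_call x0 r T K sigma =
    x0 - K * expR (- (r * T)) +
    K * expR (- (r * T)) * put_gap (L / s - s / 2) s.
Proof.
move=> x00 T0 K0 sigma0 s L; rewrite /bs_call /bs_d2 /bs_d1 /put_gap -/s.
have T0' : 0 < Num.sqrt T by rewrite sqrtr_gt0.
have s0 : 0 < s by exact: mulr_gt0.
have -> : (ln x0 - ln K + (r + sigma ^+ 2 / 2) * T) / s = L / s + s / 2.
  rewrite /L /s; move: T0' (sqr_sqrtr (ltW T0)) => + /esym TE.
  set t := Num.sqrt T in TE *; move: t TE => t -> t0.
  by field; rewrite !gt_eqF.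
have -> : L / s + s / 2 - s = L / s - s / 2 by field; rewrite gt_eqF.
have -> : s * (L / s - s / 2) + s ^+ 2 / 2 = L by field; rewrite gt_eqF.
have -> : L / s - s / 2 + s = L / s + s / 2 by field; rewrite gt_eqF.
have <- : K * expR (- (r * T)) * expR L = x0; last by ring.
rewrite -mulrA -expRD /L addrC addrK expRD expRN !lnK ?posrE//.
by rewrite mulrCA divff ?mulr1// gt_eqF.
Qed.

(** Multiply by the conjugate sum of roots, which is at least the root of y. *)
Lemma ler_dist_sqrt a b y : 0 < y -> 0 <= a -> y <= b ->
  `|Num.sqrt a - Num.sqrt b| <= `|a - b| / Num.sqrt y.
Proof.
move=> y0 a0 yb; have b0 : 0 <= b by exact: le_trans (ltW y0) yb.
rewrite ler_pdivlMr ?sqrtr_gt0// -{2}(sqr_sqrtr a0) -{2}(sqr_sqrtr b0).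
rewrite subr_sqr normrM.
rewrite ler_wpM2l// ger0_norm ?addr_ge0 ?sqrtr_ge0//.
by rewrite (le_trans (ler_wsqrtr yb))// lerDr sqrtr_ge0.
Qed.

(** The constants depend only on [x0], [r] and [T], which makes the estimate uniform in [K], the put
    price [p] and the solution [sigma]. *)
Lemma implied_volatility_estimate (x0 r T : R) :
  0 < x0 -> 0 <= r -> 0 < T ->
  exists alpha eps : R, [/\ 0 < alpha, 0 < eps < 1 &
    forall K p sigma : R, 0 < K <= 1 -> 1 <= ln x0 - ln K + r * T ->
      0 < p -> p < K * expR (- (r * T)) * eps -> 0 < sigma ->
      bs_call x0 r T K sigma = x0 - K * expR (- (r * T)) + p ->
      `|sigma - Num.sqrt 2 / Num.sqrt T *
         (Num.sqrt (ln (1 / p)) - Num.sqrt (ln (K / p)))| <=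
      alpha * ((ln (K / p)) `^ (- (1 / 2)) * ln (ln (K / p)))].
Proof.
move=> x00 r0 T0.
have sT0 : 0 < Num.sqrt T by rewrite sqrtr_gt0.
have rT0 : 0 <= r * T by rewrite mulr_ge0// ltW.
have s20 : 0 < Num.sqrt 2 :> R by rewrite sqrtr_gt0.
pose c0 := `|ln (phi 0 * expR (- 4) / 3)|.
pose c := `|ln x0 + r * T|.
(* Two differences of roots each contribute 3 ln y + c0 + r T, and one of them also c; [1 <= ln y]
   absorbs the constants. *)
pose beta := 6 + 2 * c0 + 2 * (r * T) + c.
have c00 : 0 <= c0 by exact: normr_ge0.
have c10 : 0 <= c by exact: normr_ge0.
have beta0 : 0 < beta by rewrite /beta; lra.
(* The first entry gives ln (K/p) >= e, hence ln ln (K/p) >= 1; the second makes [half_sqr_put_gap]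
   applicable. *)
pose eps : R := Num.min (expR (- expR 1)) (put_gap_minorant 1).
have eps0 : 0 < eps by rewrite lt_min expR_gt0 put_gap_minorant_gt0.
exists (Num.sqrt 2 / Num.sqrt T * beta), eps; split.
- by rewrite mulr_gt0// divr_gt0.
- rewrite eps0 gt_min; apply/orP; left.
  by rewrite -[ltRHS]expR0 ltr_expR oppr_lt0 expR_gt0.
move=> K p sigma /andP[K0 K1] L1 p0 peps sigma0.
rewrite bs_callE//; set s := sigma * _; set L := ln x0 - ln K + r * T in L1 *.
set k := K * expR (- (r * T)); set d := L / s - s / 2.
have k0 : 0 < k by rewrite mulr_gt0 ?expR_gt0.
move=> /addrI/esym pE.
have s0 : 0 < s by exact: mulr_gt0.
have LE : s * d + s ^+ 2 / 2 = L by rewrite /d; field; rewrite gt_eqF.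
have gE : put_gap d s = p / k by rewrite pE mulrAC divff ?mul1r// gt_eqF.
have geps : put_gap d s < eps by rewrite gE ltr_pdivrMr// mulrC.
have [||d1 zy yz] := half_sqr_put_gap (d := d) s0; first by rewrite LE.
  by rewrite (lt_le_trans geps)// ge_min lexx orbT.
have d0 : 0 < d by exact: lt_le_trans d1.
set y := ln (K / p).
have lgE : - ln (put_gap d s) = y - r * T.
  rewrite gE ln_div ?posrE// /y ln_div ?posrE// /k lnM ?posrE ?expR_gt0//.
  by rewrite expRK; ring.
rewrite lgE in zy yz.
have y1 : expR 1 <= y.
  have : expR 1 <= - ln (put_gap d s).
    rewrite lerNr -ler_expR lnK ?posrE ?gE ?divr_gt0// -gE.
    by rewrite (le_trans (ltW geps))// ge_min lexx.
  by rewrite lgE; lra.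
have y2 : 2 <= y by have := expR_ge1Dx (1 : R); lra.
have y0 : 0 < y by lra.
have lny : 1 <= ln y by rewrite -ler_expR lnK.
(* From d^2 <= 2 y and y >= 2 follows d <= y. *)
have lnd : ln d <= ln y.
  rewrite ler_ln ?posrE//; nra.
set z := d ^+ 2 / 2 in zy yz.
have z0 : 0 <= z by rewrite divr_ge0 ?sqr_ge0.
have yzd : `|y - z| <= 3 * ln y + c0 + r * T.
  have := ler_norm (- ln (phi 0 * expR (-4) / 3)); rewrite normrN -/c0 => ?.
  by rewrite ger0_norm; lra.
have p1 : ln (1 / p) = y - ln K by rewrite /y !ln_div ?posrE// ln1; ring.
have lnK0 : ln K <= 0 by rewrite ln_le0.
have sy0 : 0 < Num.sqrt y by rewrite sqrtr_gt0.
have dE : d = Num.sqrt 2 * Num.sqrt z.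
  by rewrite -sqrtrM// /z mulrC divfK// sqrtr_sqr ger0_norm// ltW.
(* The positive root of s d + s^2/2 = L, since (d + s)^2 = 2 (z + L). *)
have sE : s = Num.sqrt 2 * (Num.sqrt (z + L) - Num.sqrt z).
  rewrite mulrBr -dE -sqrtrM//.
  have -> : 2 * (z + L) = (d + s) ^+ 2 by rewrite -LE /z; field.
  by rewrite sqrtr_sqr ger0_norm; [ring|lra].
have -> : sigma = s / Num.sqrt T by rewrite /s mulfK// gt_eqF.
rewrite p1 {1}sE.
rewrite (_ : _ - _ = Num.sqrt 2 / Num.sqrt T *
  ((Num.sqrt (z + L) - Num.sqrt (y - ln K)) -
   (Num.sqrt z - Num.sqrt y))); last first.
  by field; rewrite gt_eqF.
rewrite normrM ger0_norm ?divr_ge0 ?sqrtr_ge0// -[leRHS]mulrA.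
rewrite ler_pM2l ?divr_gt0// powRN -[1 / 2]/(1 * 2^-1) mul1r.
rewrite powR12_sqrt ?(ltW y0)//.
rewrite (le_trans (ler_normB _ _))//.
have b1 : `|Num.sqrt (z + L) - Num.sqrt (y - ln K)| <=
    `|(z + L) - (y - ln K)| / Num.sqrt y.
  by apply: ler_dist_sqrt => //; lra.
have b2 : `|Num.sqrt z - Num.sqrt y| <= `|z - y| / Num.sqrt y.
  exact: ler_dist_sqrt.
(* The unbounded term ln K cancels between L and ln (1/p). *)
have b3 : `|(z + L) - (y - ln K)| <= `|y - z| + c.
  rewrite (_ : _ - _ = - (y - z) + (ln x0 + r * T)); last by rewrite /L; ring.
  by rewrite (le_trans (ler_normD _ _))// normrN.
rewrite (le_trans (lerD b1 b2))// -mulrDl.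
have -> : beta * ((Num.sqrt y)^-1 * ln y) = beta * ln y / Num.sqrt y by ring.
rewrite ler_pM2r ?invr_gt0// [`|z - y|]distrC.
rewrite /beta; nra.
Qed.

End implied_volatility_asymptotics.

(** * Integrability, parity and size of option payoffs *)

Section option_payoffs.
Context {R : realType} {d : measure_display} {Omega : measurableType d}.
Variable Q : probability Omega R.
Implicit Types (Y : Omega -> R) (K : R).

Lemma put_payoff_measurable Y K : measurable_fun setT Y ->
  measurable_fun setT (fun w => Num.max (K - Y w) 0).
Proof.
by move=> mY; apply: measurable_maxr => //; exact: measurable_funB.
Qed.

Lemma put_payoff_integrable Y K : measurable_fun setT Y ->
  (forall w, 0 < Y w) -> 0 <= K ->
  Q.-integrable setT (EFin \o (fun w => Num.max (K - Y w) 0)).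
Proof.
move=> mY Y0 K0.
apply: (le_integrable _ _ _ (finite_measure_integrable_cst Q K measurableT)) => //.
  by apply/measurable_EFinP; exact: put_payoff_measurable.
move=> w _ /=; rewrite lee_fin !ger0_norm// ?le_max ?lexx ?orbT//.
by rewrite ge_max K0 andbT gerBl ltW.
Qed.

(** Expectation of the pointwise identity (Y - K)^+ = (Y - K) + (K - Y)^+. *)
Lemma put_call_parity Y K : Q.-integrable setT (EFin \o Y) ->
  (forall w, 0 < Y w) -> 0 <= K ->
  fine 'E_Q[fun w => Num.max (Y w - K) 0] =
    fine 'E_Q[Y] - K + fine 'E_Q[fun w => Num.max (K - Y w) 0].
Proof.
move=> iY Y0 K0.
have mY : measurable_fun setT Y by apply/measurable_EFinP; exact: measurable_int iY.
have LY : Y \in Lfun Q 1 by exact/Lfun1_integrable.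
have LK : (cst K : Omega -> R) \in Lfun Q 1.
  by apply/Lfun1_integrable; exact: finite_measure_integrable_cst.
have LP : (fun w => Num.max (K - Y w) 0) \in Lfun Q 1.
  by apply/Lfun1_integrable; exact: put_payoff_integrable.
have -> : (fun w => Num.max (Y w - K) 0) =
    (Y \- cst K) \+ (fun w => Num.max (K - Y w) 0).
  apply/funext => w /=; case: (leP (Y w) K) => h.
    by rewrite max_r ?max_l; lra.
  by rewrite max_l ?max_r; lra.
have LYK : Y \- cst K \in Lfun Q 1.
  apply/Lfun1_integrable; rewrite /comp; under eq_fun do rewrite EFinB.
  by apply: integrableB => //; exact/Lfun1_integrable.
rewrite expectationD// fineD ?expectation_fin_num//; congr (_ + _).
by rewrite expectationB// fineB ?expectation_fin_num// expectation_cst.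
Qed.

(** The payoff vanishes where Y > K and is at most K elsewhere, by positivity of Y. *)
Lemma put_payoff_le Y K : measurable_fun setT Y -> (forall w, 0 < Y w) ->
  0 <= K -> 0 <= fine 'E_Q[fun w => Num.max (K - Y w) 0] <=
    K * fine (Q (Y @^-1` `]-oo, K])).
Proof.
move=> mY Y0 K0; set A := Y @^-1` _.
have mA : measurable A by rewrite -[A]setTI; exact: mY.
have LP : (fun w => Num.max (K - Y w) 0) \in Lfun Q 1.
  by apply/Lfun1_integrable; exact: put_payoff_integrable.
apply/andP; split.
  by apply: fine_ge0; apply: expectation_ge0 => w; rewrite le_max lexx orbT.
rewrite -lee_fin EFinM !fineK ?expectation_fin_num ?fin_num_measure//.
rewrite -(expectation_indic Q mA).
have LA : \1_A \in Lfun Q 1.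
  by apply/Lfun1_integrable; exact: integrable_indic.
rewrite -expectationZl//; apply: expectation_le.
- exact: put_payoff_measurable.
- by apply: measurable_funM => //; exact: measurable_indic.
- by move=> w; rewrite le_max lexx orbT.
- by move=> w; rewrite mulr_ge0.
apply: aeW => w /=; rewrite indicE.
have [wA|wA] := boolP (w \in A).
  by rewrite mul1r ge_max K0 andbT gerBl ltW.
rewrite mul0r ge_max lexx andbT subr_le0 leNgt; apply/negP => YK.
by move/negP: wA; apply; rewrite inE /A/= in_itv/= ltW.
Qed.

(** The distribution function of a positive variable vanishes at 0 and is right continuous there. *)
Lemma cdf_pos_near0 Y (e : R) : measurable_fun setT Y -> (forall w, 0 < Y w) ->
  0 < e -> \forall K \near 0^'+, fine (Q (Y @^-1` `]-oo, K])) < e.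
Proof.
move=> mY Y0 e0.
pose X : {RV Q >-> R} := HB.pack Y (isMeasurableFun.Build _ _ _ _ Y mY).
have Y00 : Y @^-1` `]-oo, 0] = set0.
  rewrite -subset0 => w /=; rewrite in_itv/= => /(lt_le_trans (Y0 w)).
  by rewrite ltxx.
have c0 : cdf X 0 = (0 : R)%:E by rewrite -[LHS]/(Q (Y @^-1` _)) Y00 measure0.
have /fine_cvg/cvgr0Pnorm_lt/(_ _ e0) : cdf X K @[K --> (0:R)^'+] --> (0:R)%:E.
  by rewrite -c0; exact: cdf_right_continuous.
by apply: filterS => K; apply: le_lt_trans; exact: ler_norm.
Qed.

End option_payoffs.

(** * Expectation of the discounted stock price *)

Section stock_price_expectation.
Context {R : realType} {d : measure_display} {Omega : measurableType d}.
Variable Q : probability Omega R.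

Lemma stock_price_integrable F (r x0 : R) X t :
  stock_price_process Q F r x0 X -> 0 <= t ->
  Q.-integrable setT (EFin \o X t).
Proof.
move=> [_ _ _ _ _ [_ iM _]] t0.
have := integrableZl measurableT (expR (r * t)) (iM t t0).
apply: eq_integrable => // w _ /=.
by rewrite -EFinM mulrA -expRD subrr expR0 mul1r.
Qed.

(** The martingale property between times 0 and t is tested on the whole space, which belongs to
    [F 0]. *)
Lemma stock_price_expectation F (r x0 : R) X t : is_filtration F ->
  stock_price_process Q F r x0 X -> 0 <= t ->
  expR (- (r * t)) * fine 'E_Q[X t] = x0.
Proof.
move=> [sF mF _] sX t0.
have iX s : 0 <= s -> Q.-integrable setT (EFin \o X s).
  exact: stock_price_integrable sX.
have LX : X t \in Lfun Q 1 by apply/Lfun1_integrable; exact: iX.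
case: (sX) => _ _ X0 _ _ [_ _ /(_ 0 t (lexx _) t0)[_ _ /(_ setT)]].
have FT : F 0 setT.
  have [F0 + _] := sF 0 (lexx _); move=> /(_ _ F0); by rewrite setD0.
move=> /(_ FT).
have -> : (\int[Q]_w (expR (- (r * 0)) * X 0 w)%:E = x0%:E)%E.
  rewrite -(expectation_cst Q x0) expectation_def.
  apply: ae_eq_integral => //.
  - apply/measurable_EFinP; apply: measurable_funM => //; apply/measurable_EFinP.
    exact: measurable_int (iX 0 (lexx _)).
  - exact/measurable_EFinP.
  - by apply: filterS X0 => w -> _ /=; rewrite mulr0 oppr0 expR0 mul1r.
have -> : (\int[Q]_w (expR (- (r * t)) * X t w)%:E =
    (expR (- (r * t)))%:E * 'E_Q[X t])%E.
  rewrite unlock; under eq_integral do rewrite EFinM.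
  by rewrite integralZl//; exact: iX.
by move=> /(congr1 fine)/= ->; rewrite fineM// expectation_fin_num.
Qed.

End stock_price_expectation.

Theorem theorem3p5 (R : realType) (d : measure_display)
    (Omega : measurableType d) (Q : probability Omega R)
    (F : R -> set (set Omega)) (r x0 : R) (X : R -> Omega -> R) (T : R)
    (r_ge0 : 0 <= r) (x0_gt0 : 0 < x0)
    (F_filtration : is_filtration F)
    (X_stock : stock_price_process Q F r x0 X)
    (T_gt0 : 0 < T) :
  let C := call_price Q r X in
  let P := put_price Q r X T in
  let I := implied_volatility x0 r C T in
  eq_upto_bigO_at0 I
    (fun K => Num.sqrt 2 / Num.sqrt T *
       (Num.sqrt (ln (1 / P K)) - Num.sqrt (ln (K / P K))))
    (fun K => (ln (K / P K)) `^ (- (1 / 2)) * ln (ln (K / P K))).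
Proof.
move=> C P I.
have [alpha [eps [alpha0 /andP[eps0 eps1] est]]] :=
  implied_volatility_estimate x0_gt0 r_ge0 T_gt0.
exists alpha => //.
have iX := stock_price_integrable X_stock (ltW T_gt0).
have mX : measurable_fun setT (X T).
  by apply/measurable_EFinP; exact: measurable_int iX.
have X0 w : 0 < X T w by exact: spp_positive X_stock _ _ (ltW T_gt0).
have sT0 : 0 < Num.sqrt T by rewrite sqrtr_gt0.
have e0 : 0 < expR (- (r * T)) by exact: expR_gt0.
near=> K.
have K0 : 0 < K by near: K; exact: nbhs_right_gt.
have K1 : K <= 1 by near: K; exact: nbhs_right_le.
have L1 : 1 <= ln x0 - ln K + r * T.
  have : K <= expR (ln x0 + r * T - 1).
    by near: K; apply: nbhs_right_le; exact: expR_gt0.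
  by rewrite -ler_ln ?posrE ?expR_gt0// expRK; lra.
have cdfK : fine (Q (X T @^-1` `]-oo, K])) < eps.
  by near: K; exact: cdf_pos_near0.
have CE : C T K = x0 - K * expR (- (r * T)) + P K.
  rewrite /C /P /call_price /put_price put_call_parity ?(ltW K0)//.
  rewrite -[in RHS](stock_price_expectation F_filtration X_stock (ltW T_gt0)).
  by ring.
have /andP[] := put_payoff_le Q mX X0 (ltW K0).
set E := fine _ => E0 EK.
have PE : P K = expR (- (r * T)) * E by [].
have P0 : 0 <= P K by rewrite PE mulr_ge0// ltW.
(* The discounted payoff bound, with the probability that X_T <= K already below [eps]. *)
have Peps : P K < K * expR (- (r * T)) * eps.
  rewrite PE mulrAC mulrC ltr_pM2r// (le_lt_trans EK)//.
  by rewrite ltr_pM2l.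
have k0 : 0 < K * expR (- (r * T)) by rewrite mulr_gt0.
move: P0; rewrite le_eqVlt => /predU1P[P0|P0].
  (* A zero put price would need a zero gap, but the gap has a positive minorant; [xget] thus
     returns its default 0. *)
  have -> : I K = 0.
    apply: xgetPN => sigma [sigma0]; rewrite CE -P0 bs_callE// => /addrI/eqP.
    set s := sigma * _; set L := ln x0 - ln K + r * T in L1 *.
    have s0 : 0 < s by exact: mulr_gt0.
    have LE : s * (L / s - s / 2) + s ^+ 2 / 2 = L by field; rewrite gt_eqF.
    have := @put_gap_ge _ (L / s - s / 2) s s0; rewrite LE => /(_ L1) h.
    rewrite mulf_eq0 (gt_eqF k0)/= gt_eqF// (lt_le_trans _ h)//.
    by rewrite put_gap_minorant_gt0// lt_max ltr01 orbT.
  rewrite -P0 !invr0 !mulr0 ln0// sqrtr0 subrr mulr0 subrr normr0.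
  by rewrite (ln0 (lexx 0)) mulr0 mulr0.
(* A solution exists, so the value chosen by [xget] is itself a solution and the estimate applies to
   it. *)
have [sigma sigma0 sE] :
    exists2 sigma, 0 < sigma & bs_call x0 r T K sigma = C T K.
  have L0 : 0 < ln x0 - ln K + r * T by lra.
  have [|s s0 gs] := put_gap_surj (q := P K / (K * expR (- (r * T)))) L0.
    rewrite divr_gt0//= ltr_pdivrMr// mul1r (lt_trans Peps)//.
    by rewrite gtr_pMr.
  exists (s / Num.sqrt T); first exact: divr_gt0.
  rewrite bs_callE ?divr_gt0// divfK ?gt_eqF// gs CE mulrCA divff ?mulr1//.
  by rewrite gt_eqF.
have [I0 IE] : 0 < I K /\ bs_call x0 r T K (I K) = C T K.
  exact: (@xgetI _ 0 [set v | 0 < v /\ bs_call x0 r T K v = C T K] sigma).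
by apply: est; rewrite ?K0 ?K1 ?IE.
Unshelve. all: by end_near. Qed.
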